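(* Let $T$ be an out-star with centre $c$ and leaves $\ell_1,\dots,\ell_n$ (arcs $c\to\ell_i$), carrying only green pebbles: $g_0\ge0$ on $c$ and $g_i\ge 0$ on $\ell_i$. Then the game value of this \textsc{blocking pebbles} position is the nimber $*\big(g_1\oplus g_2\oplus\cdots\oplus g_n\big)$, where $\oplus$ is the nim sum.
   Context: \textsc{Blocking pebbles} with green pebbles only is an impartial game on a finite directed acyclic graph with a number of (green) pebbles on each vertex. A move by either player: choose a vertex $v$ and either (1) move a positive number of pebbles from $v$ to a single in-neighbour $u$ of $v$ (arc $u\to v$) at no cost, or (2) remove two pebbles from $v$ and place one pebble on an out-neighbour $w$ of $v$ (arc $v\to w$). Normal play. The nim sum $\oplus$ is binary addition without carry; $*n$ is the nimber $n$. *)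

(* Defs.v *)
From Stdlib Require Import PeanoNat.
From mathcomp Require Import all_boot.

Set Implicit Arguments.
Unset Strict Implicit.
Unset Printing Implicit Defensive.

(** * Combinatorial games under normal play *)

Inductive game : Type :=
  Game (L R : Type) (left_option : L -> game) (right_option : R -> game).

Fixpoint game_add (G : game) : game -> game :=
  fix addG (H : game) : game :=
    match G, H with
    | Game GL GR gl gr, Game HL HR hl hr =>
      Game (fun o : GL + HL =>
              match o with inl i => game_add (gl i) H | inr j => addG (hl j) end)
           (fun o : GR + HR =>
              match o with inl i => game_add (gr i) H | inr j => addG (hr j) end)
    end.

(** Left wins [G] when Left ([left_to_move = true]) or Right
    ([left_to_move = false]) is to move; a player without a move loses. *)
Fixpoint left_wins (G : game) (left_to_move : bool) : Prop :=
  match G with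
  | Game L R l r =>
    if left_to_move then exists i, left_wins (l i) false
    else forall j, left_wins (r j) true
  end.

(** [G] and [H] have the same value: [G + X] and [H + X] have the same outcome
    for every game [X].  The outcome class is determined by who wins when
    Left starts and who wins when Right starts. *)
Definition game_eq (G H : game) : Prop :=
  forall (X : game) (b : bool),
    left_wins (game_add G X) b <-> left_wins (game_add H X) b.

(** The game on a position [p] of a terminating ruleset [mv] in which both
    players have the same moves; [mv p q] means that [q] can be reached from
    [p] in one move. *)
Fixpoint impartial_game (T : Type) (mv : T -> T -> Prop) (p : T)
    (a : Acc (fun q p => mv p q) p) : game :=
  let option (q : {q | mv p q}) := impartial_game (Acc_inv a (proj2_sig q)) in
  Game option option.

Lemma ltn_wf : well_founded (fun m n => m < n).
Proof.
elim/ltn_ind => n IH; constructor => m; exact: IH.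
Qed.

(** [*n = { *0, ..., *(n-1) | *0, ..., *(n-1) }] *)
Definition nimber (n : nat) : game :=
  impartial_game (mv := fun n m => m < n) (ltn_wf n).

(** * Blocking pebbles with green pebbles only *)

Record dag := Dag {
  vertex :> finType;
  arc : rel vertex;
  dag_acyclic : forall s : seq vertex, cycle arc s -> s = [::]
}.

(** [p] with [a] pebbles removed from [v] and [b] pebbles put on [w]. *)
Definition transfer (V : finType) (p : {ffun V -> nat}) (v : V) (a : nat)
    (w : V) (b : nat) : {ffun V -> nat} :=
  [ffun x => p x - (if x == v then a else 0) + (if x == w then b else 0)].

Variant green_move (D : dag) (p q : {ffun D -> nat}) : Prop :=
  | MoveToInNeighbour (u v : D) (k : nat) of
      arc u v & 0 < k & k <= p v & q = transfer p v k u k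
  | MoveToOutNeighbour (v w : D) of
      arc v w & 2 <= p v & q = transfer p v 2 w 1.

Definition ancestors (D : dag) (v : D) : nat :=
  #|[pred u | connect (@arc D) u v]|.

Lemma ancestors_arc (D : dag) (u v : D) : arc u v -> ancestors u < ancestors v.
Proof.
move=> uv; apply: proper_card; apply/properP; split.
  apply/subsetP => x; rewrite !inE => xu.
  exact: connect_trans xu (connect1 uv).
exists v; rewrite !inE ?connect0 //.
apply/negP => /connectP[s vs us].
suff /dag_acyclic: cycle (@arc D) (v :: s) by [].
by rewrite /= rcons_path vs -us.
Qed.

Lemma sum_transfer (V : finType) (f : V -> nat) (p : {ffun V -> nat})
    (v w : V) (a b : nat) : a <= p v ->
  \sum_x transfer p v a w b x * f x + a * f v = \sum_x p x * f x + b * f w.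
Proof.
move=> ap.
have sum1 x c : c * f x = \sum_y (if y == x then c else 0) * f y.
  rewrite (bigD1 x) //= eqxx big1 ?addn0 // => y /negPf ->.
  by rewrite mul0n.
rewrite !sum1 -!big_split /=; apply: eq_bigr => x _; rewrite ffunE.
rewrite -!mulnDl; congr (_ * _).
by case: (x =P v) => [->|_]; [rewrite addnAC subnK | rewrite subn0 addn0].
Qed.

Lemma green_move_wf (D : dag) :
  well_founded (fun q p : {ffun D -> nat} => green_move p q).
Proof.
pose f (v : D) := #|D|.+1 + ancestors v.
pose mu (p : {ffun D -> nat}) := \sum_x p x * f x.
suff H m : forall p, mu p <= m -> Acc (fun q p => green_move p q) p.
  by move=> p; exact: (H (mu p)).
elim/ltn_ind: m => m IH p mup; constructor => q pq.
suff qp : mu q < mu p by exact: (IH (mu q) (leq_trans qp mup)).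
case: pq => [u v k uv k0 kp ->|v w vw p2 ->].
  rewrite -(ltn_add2r (k * f v)) /mu (sum_transfer f u k kp).
  by rewrite ltn_add2l ltn_pmul2l // ltn_add2l ancestors_arc.
rewrite -(ltn_add2r (2 * f v)) /mu (sum_transfer f w 1 p2).
rewrite ltn_add2l mul1n mul2n -addnn.
apply: (@leq_trans (#|D|.+1 + #|D|.+1)); last first.
  by apply: leq_add; apply: leq_addr.
by rewrite ltn_add2l ltnS; apply: max_card.
Qed.

Definition green_blocking_pebbles (D : dag) (g : {ffun D -> nat}) : game :=
  impartial_game (green_move_wf g).

Definition is_out_star (D : dag) (n : nat) (c : D) (l : 'I_n -> D) : Prop :=
  [/\ injective l,
      forall i, l i != c,
      forall v : D, v = c \/ exists i, v = l i
    & forall u v : D, arc u v <-> u = c /\ exists i, v = l i].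

Definition nim_sum (n : nat) (a : 'I_n -> nat) : nat :=
  \big[Nat.lxor/0]_(i < n) a i.

(* Main.v *)
Require Import Defs.
From Stdlib Require Import PeanoNat.
From HB Require Import structures.
From mathcomp Require Import all_boot zify.

(** The nim sum [s] of the leaves behaves like a Grundy value: every move
    changes exactly one leaf, hence changes [s], and as in Nim every [m < s] is
    reached by moving pebbles from a suitable leaf to the centre.  A move that
    raises [s] (possible because the centre can feed a leaf) is reversible: the
    opponent can restore [s] at once. *)

Section ImpartialSum.

Variables (T : Type) (mv : T -> T -> Prop).

(** [impartial_game a] reduces only once [a] is a constructor. This lemma and its companion for
    Right hide that case analysis. *)
Lemma left_wins_addT (p : T) (a : Acc (fun q p => mv p q) p)
    (L R : Type) (l : L -> game) (r : R -> game) :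
  left_wins (game_add (impartial_game a) (Game l r)) true <->
  (exists q (pq : mv p q),
     left_wins (game_add (impartial_game (Acc_inv a pq)) (Game l r)) false) \/
  (exists i, left_wins (game_add (impartial_game a) (l i)) false).
Proof.
case: a => a; split => [[[[q pq]|i] W]|[[q [pq W]]|[i W]]].
- by left; exists q, pq.
- by right; exists i.
- by exists (inl (exist _ q pq)).
- by exists (inr i).
Qed.

Lemma left_wins_addF (p : T) (a : Acc (fun q p => mv p q) p)
    (L R : Type) (l : L -> game) (r : R -> game) :
  left_wins (game_add (impartial_game a) (Game l r)) false <->
  (forall q (pq : mv p q),
     left_wins (game_add (impartial_game (Acc_inv a pq)) (Game l r)) true) /\
  (forall j, left_wins (game_add (impartial_game a) (r j)) true).
Proof.
case: a => a; split => [W|[W1 W2]].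
  by split => [q pq|j]; [exact: (W (inl (exist _ q pq)))|exact: (W (inr j))].
by move=> [[q pq]|j]; [exact: W1|exact: W2].
Qed.

End ImpartialSum.

(** The hypotheses make [s p] the mex of [s] over the options of [p]. Leaving [a] and [b] arbitrary
    avoids any appeal to proof irrelevance for [Acc]. *)
Lemma impartial_game_nimber (T : Type) (mv : T -> T -> Prop) (s : T -> nat) :
  (forall p q, mv p q -> s q <> s p) ->
  (forall p m, m < s p -> exists2 q, mv p q & s q = m) ->
  forall (p : T) (a : Acc (fun q p => mv p q) p)
    (b : Acc (fun m n => m < n) (s p)),
  game_eq (impartial_game a) (impartial_game (mv := fun n m => m < n) b).
Proof.
move=> s_neq s_lt.
pose P p := forall (a : Acc (fun q p => mv p q) p) b,
  game_eq (impartial_game a)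
          (@impartial_game _ (fun n m => m < n) (s p) b).
(* Carrying [P] for the options as well makes it available two moves below [p], where a reversing
   reply lands. *)
suff H p : Acc (fun q p => mv p q) p -> P p /\ forall q, mv p q -> P q.
  by move=> p a; have [Pp _] := H p a; exact: Pp.
elim=> {}p _ IH; split; last by move=> q /IH[].
have P1 q : mv p q -> P q by case/IH.
have P2 q q' : mv p q -> mv q q' -> P q' by move=> /IH[_]; exact.
(* Induction on the test game: [IHl] and [IHr] cover moves in it, [P1] and [P2] moves in the other
   summand. *)
move=> a b; elim=> L R l IHl r IHr [].
- rewrite !left_wins_addT; split.
  + case=> [[q [pq W]]|[i /(IHl i false) W]]; last by right; exists i.
    case: (ltngtP (s q) (s p)) => [lt_qp|lt_pq|/s_neq//].
      left; exists (s q), lt_qp.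
      by apply/(P1 q pq (Acc_inv a pq) _ (Game l r) false).
    (* Right answers by restoring the value [s p]. *)
    have [q' qq' sq'] := s_lt _ _ lt_pq.
    move/left_wins_addF: W => [/(_ q' qq') W _].
    move: (P2 q q' pq qq'); rewrite /P sq' => Pq'.
    by move/(Pq' _ b (Game l r) true): W; rewrite left_wins_addT.
  + case=> [[m [mp W]]|[i /(IHl i false) W]]; last by right; exists i.
    have [q pq sq] := s_lt _ _ mp; left; exists q, pq.
    move: (P1 q pq); rewrite /P sq => Pq.
    by apply/(Pq _ (Acc_inv b mp) (Game l r) false).
- rewrite !left_wins_addF; split.
  + case=> W1 W2; split=> [m mp|j]; last by apply/(IHr j true).
    have [q pq sq] := s_lt _ _ mp.
    move: (P1 q pq); rewrite /P sq => Pq.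
    by apply/(Pq (Acc_inv a pq) _ (Game l r) true).
  + case=> W1 W2; split=> [q pq|j]; last by apply/(IHr j true).
    case: (ltngtP (s q) (s p)) => [lt_qp|lt_pq|/s_neq//].
      by apply/(P1 q pq _ (Acc_inv b lt_qp) (Game l r) true).
    (* Now Right has raised the value and Left restores it. As [s q' = s p], the assumption on [b]
       with Right to move applies. *)
    have [q' qq' sq'] := s_lt _ _ lt_pq.
    rewrite left_wins_addT; left; exists q', qq'.
    move: (P2 q q' pq qq'); rewrite /P sq' => Pq'.
    by apply/(Pq' _ b (Game l r) false); rewrite left_wins_addF.
Qed.

HB.instance Definition _ := Monoid.isComLaw.Build nat 0 Nat.lxor
  (fun x y z => esym (Nat.lxor_assoc x y z)) Nat.lxor_comm Nat.lxor_0_l.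

Lemma lxorKl (x y : nat) : Nat.lxor x (Nat.lxor x y) = y.
Proof. by rewrite -Nat.lxor_assoc Nat.lxor_nilpotent Nat.lxor_0_l. Qed.

(** Halving shifts the deciding bit down to position 0, where the halves agree and parity
    decides. *)
Lemma ltn_testbit (k x y : nat) :
  Nat.testbit x k = false -> Nat.testbit y k = true ->
  (forall j, k < j -> Nat.testbit x j = Nat.testbit y j) -> x < y.
Proof.
elim: k x y => [|k IH] x y xk yk eq_xy;
  have xE := Nat.div2_odd x; have yE := Nat.div2_odd y.
  have eq2 : Nat.div2 x = Nat.div2 y.
    by apply: Nat.bits_inj => j; rewrite !Nat.testbit_div2; exact: eq_xy.
  move: xE yE; rewrite -!Nat.bit0_odd xk yk eq2 /=; lia.
have lt2 : Nat.div2 x < Nat.div2 y.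
  by apply: IH; rewrite ?Nat.testbit_div2 // => j kj;
    rewrite !Nat.testbit_div2; exact: eq_xy.
move: xE yE; case: (Nat.odd x); case: (Nat.odd y) => /=; lia.
Qed.

Lemma nim_sumD1 (n : nat) (a : 'I_n -> nat) (i : 'I_n) :
  nim_sum a = Nat.lxor (a i) (\big[Nat.lxor/0]_(j < n | j != i) a j).
Proof. by rewrite /nim_sum (bigD1 i). Qed.

Lemma nim_sum_testbit (n : nat) (a : 'I_n -> nat) (k : nat) :
  Nat.testbit (nim_sum a) k -> exists i, Nat.testbit (a i) k.
Proof.
move=> sk; apply/existsP; apply: contraLR sk => /existsPn a0.
rewrite /nim_sum; elim/big_ind: _ => [|x y /negPf x0 /negPf y0|i _].
- by rewrite Nat.bits_0.
- by rewrite Nat.lxor_spec x0 y0.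
- exact: a0.
Qed.

(** Bouton's argument: the top bit of [d] is set in some [a i]. Adding [d] clears it and keeps all
    higher bits. *)
Lemma nim_sum_lt (n : nat) (a : 'I_n -> nat) (m : nat) : m < nim_sum a ->
  exists i, Nat.lxor (a i) (Nat.lxor (nim_sum a) m) < a i.
Proof.
set s := nim_sum a => lt_ms; set d := Nat.lxor s m.
have d0 : d <> 0 by move/Nat.lxor_eq; lia.
pose k := Nat.log2 d.
have dk : Nat.testbit d k = true by exact: Nat.bit_log2.
have dj j : k < j -> Nat.testbit d j = false.
  by move=> kj; apply: Nat.bits_above_log2; apply/ltP.
have [i ik] : exists i, Nat.testbit (a i) k.
  (* Were bit [k] clear in [s], it would be set in [m], forcing [s < m]. *)
  apply: nim_sum_testbit; apply: contraLR lt_ms => /negPf sk.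
  rewrite -leqNgt ltnW //; apply: (@ltn_testbit k) => //.
    by move: dk; rewrite Nat.lxor_spec -/s sk; case: Nat.testbit.
  move=> j /dj; rewrite Nat.lxor_spec.
  by case: Nat.testbit; case: Nat.testbit.
exists i; apply: (@ltn_testbit k) => //.
  by rewrite Nat.lxor_spec dk ik.
by move=> j /dj jd; rewrite Nat.lxor_spec jd; case: Nat.testbit.
Qed.

(** Nim addition of the common remaining terms [r] is cancellable. *)
Lemma nim_sum_neq (n : nat) (a b : 'I_n -> nat) (i : 'I_n) :
  b i <> a i -> (forall j, j != i -> b j = a j) -> nim_sum b <> nim_sum a.
Proof.
move=> neq_ab eq_ab; rewrite !(@nim_sumD1 _ _ i) (eq_bigr _ eq_ab).
set r := bigop.body _ _ _; rewrite ![Nat.lxor _ r]Nat.lxor_comm => E.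
by apply: neq_ab; rewrite -[LHS](lxorKl r) E lxorKl.
Qed.

Theorem theorem7 (D : dag) (n : nat) (c : D) (l : 'I_n -> D)
    (g : {ffun D -> nat}) :
  is_out_star c l ->
  game_eq (green_blocking_pebbles g) (nimber (nim_sum (fun i => g (l i)))).
Proof.
case=> l_inj l_c _ arcE.
pose s (p : {ffun D -> nat}) := nim_sum (fun i => p (l i)).
have l_eq i j : (l i == l j) = (i == j) by apply: inj_eq.
apply: (@impartial_game_nimber _ (@green_move D) s) => [p q|p m].
(* Every arc joins [c] to a leaf, so the first kind of move lowers one leaf by [k] and the second
   raises one leaf by 1. *)
- case=> [u v k /arcE[-> [i ->]] k0 kp ->|v w /arcE[-> [i ->]] p2 ->].
    apply: (@nim_sum_neq _ _ _ i) => [|j /negPf ji];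
      rewrite ffunE (negPf (l_c _)).
      rewrite eqxx; lia.
    by rewrite l_eq ji subn0 addn0.
  apply: (@nim_sum_neq _ _ _ i) => [|j /negPf ji];
    rewrite ffunE (negPf (l_c _)).
    rewrite eqxx; lia.
  by rewrite l_eq ji subn0 addn0.
- case/nim_sum_lt => i; set x := Nat.lxor _ _ => lt_x.
  (* Leaf [i] is cut down to [x]; the surplus goes to the centre, which [s] ignores. *)
  exists (transfer p (l i) (p (l i) - x) c (p (l i) - x)).
    apply: (@MoveToInNeighbour _ _ _ c (l i) (p (l i) - x)) => //;
      rewrite ?subn_gt0 ?leq_subr //.
    by apply/arcE; split=> //; exists i.
  rewrite /s (@nim_sumD1 _ _ i) ffunE eqxx (negPf (l_c _)).
  under eq_bigr => j ji.
    rewrite ffunE l_eq (negPf ji) (negPf (l_c _)) subn0 addn0; over.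
  rewrite subKn ?addn0; last exact: ltnW.
  (* With the nim sum inside [x] split at [i], [p (l i)] and the remaining sum each occur twice and
     cancel, leaving [m]. *)
  rewrite /x (@nim_sumD1 _ _ i) Nat.lxor_comm.
  by rewrite !Nat.lxor_assoc lxorKl lxorKl.
Qed.
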